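(* Let $H$ be a graph. The class of $H$-free graphs is bounded-apex-interval if and only if $H$ is an induced subgraph of $P_3$.
   Context: All graphs are finite and simple. $P_3$ is the path on three vertices. ''Induced subgraph of $X$'' means isomorphic to $X[S]$ for some $S\subseteq V(X)$. A graph is $H$-free if none of its induced subgraphs is isomorphic to $H$. An interval graph is the intersection graph of a finite set of intervals of $\mathbb{R}$. A class of graphs is bounded-apex-interval if there is a constant $c\in\mathbb{N}$ such that every graph $G$ in the class has a set $S\subseteq V(G)$ with $|S|\le c$ such that $G-S$ is an interval graph. *)

(* Defs.v *)
From mathcomp Require Import all_boot all_order all_algebra.
From mathcomp Require Import classical_sets reals num_normedtype.

Set Implicit Arguments.
Unset Strict Implicit.
Unset Printing Implicit Defensive.

Record graph := Graph {
  vertex :> finType;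
  adj : rel vertex;
  adj_sym : symmetric adj;
  adj_irrefl : irreflexive adj }.

Definition isomorphic (G G' : graph) : Prop :=
  exists2 f : G -> G', bijective f & forall u v : G, adj (f u) (f v) = adj u v.

Section Induced.
Variables (G : graph) (S : {set G}).

Definition induced_adj : rel {x : G | x \in S} :=
  fun u v => adj (val u) (val v).

Lemma induced_adj_sym : symmetric induced_adj.
Proof. by move=> u v; exact: adj_sym. Qed.

Lemma induced_adj_irrefl : irreflexive induced_adj.
Proof. by move=> u; exact: adj_irrefl. Qed.

Definition induced : graph := Graph induced_adj_sym induced_adj_irrefl.
End Induced.

Definition induced_subgraph_of (H G : graph) : Prop :=
  exists S : {set G}, isomorphic H (induced S).

Definition graph_minus (G : graph) (S : {set G}) : graph := induced (~: S).

Definition H_free (H G : graph) : Prop :=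
  forall S : {set G}, ~ isomorphic (induced S) H.

Definition P3_adj : rel 'I_3 :=
  fun i j => (i.+1 == j :> nat) || (j.+1 == i :> nat).

Lemma P3_adj_sym : symmetric P3_adj.
Proof. by move=> i j; rewrite /P3_adj orbC. Qed.

Lemma P3_adj_irrefl : irreflexive P3_adj.
Proof. by move=> i; rewrite /P3_adj orbb -[X in _ == X]addn0 -addn1 eqn_add2l. Qed.

Definition P3 : graph := Graph P3_adj_sym P3_adj_irrefl.

(* The intervals are nonempty and may be open, closed, half-open or unbounded.
   Injectivity makes the vertices of [G] correspond to the elements of a set,
   not a multiset, of intervals. *)
Definition interval_graph (R : realType) (G : graph) : Prop :=
  exists I : G -> set R,
    [/\ injective I,
        forall v, is_interval (I v) /\ (I v !=set0)%classic
      & forall u v, adj u v <-> u <> v /\ (I u `&` I v !=set0)%classic].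

Definition bounded_apex_interval (R : realType) (C : graph -> Prop) : Prop :=
  exists c : nat, forall G : graph, C G ->
    exists2 S : {set G}, #|S| <= c & interval_graph R (graph_minus S).

(* Main.v *)
From mathcomp Require Import all_boot all_order all_algebra.
From mathcomp Require Import boolp classical_sets reals.
From mathcomp Require Import connected num_normedtype normed_module.
Require Import Defs.

Set Implicit Arguments.
Unset Strict Implicit.
Unset Printing Implicit Defensive.

Import Order.TTheory GRing.Theory Num.Theory.

(** The class of H-free graphs grows with H, and the graphs without an induced
    P3 are the disjoint unions of cliques, which are interval graphs: no vertex
    has to be deleted (lemma [P3_free_interval]).  This settles one direction.

    Conversely, two families of graphs are arbitrarily far from being interval
    graphs: disjoint unions of 5-cycles, and complete multipartite graphs with
    all parts of size two.  Deleting c vertices from c + 1 disjoint 5-cycles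
    leaves one of them intact, and deleting c vertices from a graph with c + 2
    parts leaves two parts intact, which form a 4-cycle; neither cycle is an
    interval graph (lemmas [interval_graph_C5] and [interval_graph_C4]).  So if
    the H-free graphs are bounded-apex-interval, then H is an induced subgraph
    of some member of each family.  From the first family H has no triangle and no 4-cycle, from the second each vertex of H
    has at most one non-neighbour, and these constraints only leave the induced
    subgraphs of P3 (lemma [embeds_P3]).  The first family has to consist of
    5-cycles rather than 4-cycles: a 4-cycle occurs in the second family too, and
    would remain as a candidate for H. *)

(** * Embeddings *)

(** Induced subgraphs up to isomorphism, as maps: unlike a vertex set together
    with an isomorphism, such maps compose and are given by plain formulas. *)
Definition embeds (H G : graph) : Prop :=
  exists2 f : H -> G, injective f & forall u v, adj (f u) (f v) = adj u v.

Lemma isomorphic_sym (G G' : graph) : isomorphic G G' -> isomorphic G' G.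
Proof.
move=> [f [g fK gK] fadj]; exists g; first by exists f.
by move=> u v; rewrite -fadj !gK.
Qed.

Lemma induced_subgraphE (H G : graph) : induced_subgraph_of H G <-> embeds H G.
Proof.
split=> [[S [f fbij fadj]]|[f finj fadj]].
  exists (fun u => val (f u)); last exact: fadj.
  exact: inj_comp val_inj (bij_inj fbij).
exists [set f u | u : H].
have fS u : f u \in [set f u | u : H] by apply: imset_f.
pose F u : induced [set f u | u : H] := exist _ (f u) (fS u).
exists F => [|u v]; last exact: fadj.
have Finj : injective F by move=> u v /(congr1 val) /finj.
apply: (inj_card_bij Finj).
by rewrite card_sig (@eq_card _ _ (mem [set f u | u : H])) ?card_imset.
Qed.

Lemma embeds_trans (H G K : graph) : embeds H G -> embeds G K -> embeds H K.
Proof.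
move=> [f finj fadj] [g ginj gadj]; exists (g \o f); first exact: inj_comp.
by move=> u v; rewrite /= gadj fadj.
Qed.

Lemma embeds_induced (G : graph) (S : {set G}) : embeds (induced S) G.
Proof. by exists val => //; apply: val_inj. Qed.

Lemma H_freeE (H G : graph) : H_free H G <-> ~ embeds H G.
Proof.
rewrite -induced_subgraphE; split=> [free [S] | free S].
  by move=> /isomorphic_sym; apply: free.
by move=> iso; apply: free; exists S; apply: isomorphic_sym.
Qed.

(** * Disjoint unions of cliques *)

Lemma P3_free_trans (G : graph) (u v w : G) :
  ~ embeds P3 G -> adj u v -> adj v w -> u != w -> adj u w.
Proof.
move=> free uv vw uw; apply: contra_notT free => /negbTE nuw.
have neq (x y : G) : adj x y -> (x == y) = false.
  by move=> xy; apply: contraTF xy => /eqP ->; rewrite adj_irrefl.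
have [vu wv] : adj v u /\ adj w v by rewrite [adj v u]adj_sym [adj w v]adj_sym.
have nwu : adj w u = false by rewrite adj_sym.
pose f (i : P3) : G := nth u [:: u; v; w] (i : 'I_3).
exists f.
  move=> i j /eqP fij; apply/val_inj/eqP; move: fij.
  rewrite /f nth_uniq //=; try exact: ltn_ord.
  by rewrite !inE negb_or uw !neq.
move=> i j; rewrite /f /= /P3_adj.
case: i => [[|[|[|]]] //= ?]; case: j => [[|[|[|]]] //= ?];
  rewrite ?adj_irrefl ?uv ?vw ?vu ?wv ?nuw ?nwu //.
Qed.

(** The component of rank [k] is placed in the block from [N * k] to [N * k + N - 1],
    with [N] the number of vertices.  The intervals of its vertices share their
    left end, so they meet, and have different right ends, because an interval
    representation must be injective. *)
Lemma P3_free_interval (R : realType) (G : graph) :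
  ~ embeds P3 G -> interval_graph R G.
Proof.
move=> free; pose nb (u : G) : {set G} := [set v | (v == u) || adj u v].
(* Without an induced P3, the closed neighbourhoods are the components. *)
have nbE u v : nb u = nb v <-> u = v \/ adj u v.
  split=> [|[->//|uv]].
    by move/setP/(_ v); rewrite !inE eqxx => /orP[/eqP ->|]; [left | right].
  have sub x y : adj x y -> nb x \subset nb y.
    move=> xy; apply/fintype.subsetP => z; rewrite !inE => /orP[/eqP ->|xz].
      by rewrite adj_sym xy orbT.
    case: eqVneq => //= zy; apply: (P3_free_trans free _ xz); last by rewrite eq_sym.
    by rewrite adj_sym.
  by apply/eqP; rewrite finset.eqEsubset !sub // adj_sym.
pose l u := (enum_rank (nb u) * #|G|)%N.
pose r u := (l u + enum_rank u)%N.
have lr u v : l u <= r v -> enum_rank (nb u) <= enum_rank (nb v).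
  move=> luv; rewrite -ltnS -(ltn_pmul2r (_ : 0 < #|G|)); last first.
    by apply/card_gt0P; exists u.
  apply: leq_ltn_trans luv _; rewrite mulSnr ltn_add2l.
  exact: ltn_ord.
exists (fun u => [set x : R | ((l u)%:R <= x <= (r u)%:R)%R]%classic).
have lin u : [set x : R | ((l u)%:R <= x <= (r u)%:R)%R]%classic (l u)%:R%R.
  by rewrite /= lexx ler_nat leq_addr.
have rin u : [set x : R | ((l u)%:R <= x <= (r u)%:R)%R]%classic (r u)%:R%R.
  by rewrite /= lexx ler_nat leq_addr.
split.
- move=> u v uv.
  have := lin u; rewrite uv /= !ler_nat => /andP[lvu _].
  have := lin v; rewrite -uv /= !ler_nat => /andP[luv _].
  have := rin u; rewrite uv /= !ler_nat => /andP[_ ruv].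
  have := rin v; rewrite -uv /= !ler_nat => /andP[_ rvu].
  have luvE : l u = l v by apply/eqP; rewrite eqn_leq luv lvu.
  have : r u = r v by apply/eqP; rewrite eqn_leq ruv rvu.
  by rewrite /r luvE => /addnI /val_inj /enum_rank_inj.
- move=> u; split; last by exists (l u)%:R%R.
  move=> x y /= /andP[lx _] /andP[_ yr] z /andP[xz zy].
  by rewrite (le_trans lx xz) (le_trans zy yr).
move=> u v; split=> [uv|[uv [x /= [/andP[lu ru] /andP[lv rv]]]]].
  split; first by move=> E; move: uv; rewrite E adj_irrefl.
  exists (l u)%:R%R; split; first exact: lin.
  have -> : l u = l v by rewrite /l (iffRL (nbE u v)) //; right.
  exact: lin.
have lurv : l u <= r v by rewrite -(ler_nat R) (le_trans lu rv).
have lvru : l v <= r u by rewrite -(ler_nat R) (le_trans lv ru).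
have /nbE [] // : nb u = nb v.
by apply/enum_rank_inj/val_inj/eqP; rewrite eqn_leq !lr.
Qed.

(** * Cycles of length four and five are not interval graphs *)

Local Open Scope classical_set_scope.

(** If [A] and [C] are disjoint, say with [A] on the left, then the intervals [B]
    and [D] both reach from [A] to [C] across the gap, so they have a common point
    in [A]. *)
Lemma interval_C4 (R : realType) (A B C D : set R) :
  is_interval A -> is_interval B -> is_interval C -> is_interval D ->
  A `&` B !=set0 -> B `&` C !=set0 -> C `&` D !=set0 -> D `&` A !=set0 ->
  A `&` C !=set0 \/ B `&` D !=set0.
Proof.
wlog suff: A C / is_interval A -> is_interval B -> is_interval C -> is_interval D ->
  A `&` B !=set0 -> B `&` C !=set0 -> C `&` D !=set0 -> D `&` A !=set0 ->
  (exists a c, [/\ A a, C c & (a <= c)%R]) ->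
  A `&` C !=set0 \/ B `&` D !=set0.
  move=> oriented iA iB iC iD AB BC CD DA.
  have [[a [Aa _]] [c [_ Cc]]] := (AB, BC).
  have [ac|/ltW ca] := leP a c; first by apply: oriented => //; exists a, c.
  rewrite (setIC A C); apply: oriented => //; rewrite 1?setIC //.
  by exists c, a.
move=> iA iB iC iD [p [Ap Bp]] [q [Bq Cq]] [s [Cs Ds]] [t [Dt At]] [a [c [Aa Cc ac]]].
have [[x AC]|disj] := pselect (A `&` C !=set0); [by left; exists x | right].
(* Disjointness propagates the order of [a] and [c] to all of [A] and [C]. *)
have Ac x : A x -> (x <= c)%R.
  move=> Ax; rewrite leNgt; apply/negP => cx; apply: disj; exists c; split=> //.
  by apply: iA Aa Ax _ _; rewrite ac ltW.
have AC x y : A x -> C y -> (x <= y)%R.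
  move=> Ax Cy; rewrite leNgt; apply/negP => yx; apply: disj; exists x; split=> //.
  by apply: iC Cy Cc _ _; rewrite Ac // ltW.
(* To the right of both [p] and [t], and still to the left of [C]. *)
exists (Num.max p t); have Am : A (Num.max p t) by case: leP.
split; [apply: iB Bp Bq _ _ | apply: iD Dt Ds _ _];
  by rewrite le_max lexx ?orbT /= AC.
Qed.

Lemma is_intervalU (R : realType) (A B : set R) :
  is_interval A -> is_interval B -> A `&` B !=set0 -> is_interval (A `|` B).
Proof.
by rewrite -!connected_intervalP => cA cB AB; apply: connectedU.
Qed.

Lemma interval_graph_meet (R : realType) (G : graph) :
  interval_graph R G ->
  exists I : G -> set R, (forall v, is_interval (I v)) /\
    (forall u v, I u `&` I v !=set0 <-> (u == v) || adj u v).
Proof.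
move=> [I [_ Iint Iadj]]; exists I; split=> [v|u v]; first by case: (Iint v).
split=> [uv|]; first by case: eqVneq => //= /eqP nuv; apply/Iadj.
case: eqVneq => [-> _|_ /= /Iadj [] //].
by rewrite setIid; case: (Iint v).
Qed.

Lemma interval_graph_C4 (R : realType) (G : graph) (a b c d : G) :
  interval_graph R G -> adj a b -> adj b c -> adj c d -> adj d a ->
  [|| a == c, adj a c, b == d | adj b d].
Proof.
move=> /interval_graph_meet [I [Iint IP]] ab bc cd da.
have meet u v : adj u v -> I u `&` I v !=set0 by move=> uv; apply/IP; rewrite uv orbT.
have [/IP|/IP] := interval_C4 (Iint a) (Iint b) (Iint c) (Iint d)
    (meet _ _ ab) (meet _ _ bc) (meet _ _ cd) (meet _ _ da).
  by rewrite orbA => ->.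
by move=> bd; rewrite orbA bd orbT.
Qed.

(** Merging the intervals of the adjacent vertices [d] and [e] turns a 5-cycle
    into a 4-cycle. *)
Lemma interval_graph_C5 (R : realType) (G : graph) (a b c d e : G) :
  interval_graph R G -> adj a b -> adj b c -> adj c d -> adj d e -> adj e a ->
  [\/ (a == c) || adj a c, (b == d) || adj b d | (b == e) || adj b e].
Proof.
move=> /interval_graph_meet [I [Iint IP]] ab bc cd de ea.
have meet u v : adj u v -> I u `&` I v !=set0 by move=> uv; apply/IP; rewrite uv orbT.
have [x [cx dx]] := meet _ _ cd; have [y [ey ay]] := meet _ _ ea.
have cde : I c `&` (I d `|` I e) !=set0 by exists x; split=> //; left.
have dea : (I d `|` I e) `&` I a !=set0 by exists y; split=> //; right.
have [/IP|[z [bz dez]]] := interval_C4 (Iint a) (Iint b) (Iint c)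
    (is_intervalU (Iint d) (Iint e) (meet _ _ de))
    (meet _ _ ab) (meet _ _ bc) cde dea; first by constructor 1.
by case: dez => ?; [constructor 2 | constructor 3]; apply/IP; exists z.
Qed.

Local Close Scope classical_set_scope.

(** * Two families far from the interval graphs *)

(** Each deleted vertex spoils at most one of the [m] blocks. *)
Lemma card_intact_blocks (T : finType) (m : nat) (S : {set T * 'I_m}) :
  m - #|S| <= #|[set j | [forall t, (t, j) \notin S]]|.
Proof.
rewrite leq_subLR -{1}(card_ord m) -(cardsC (snd @: S)).
apply: leq_add (leq_imset_card _ _) (subset_leq_card _).
apply/fintype.subsetP => j; rewrite !inE => jS; apply/forallP => t.
by apply: contra jS => tj; apply/imsetP; exists (t, j).
Qed.

Definition C5_adj : rel 'I_5 :=
  fun i j => (i.+1 %% 5 == j) || (j.+1 %% 5 == i).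

Lemma C5_adj_sym : symmetric C5_adj.
Proof. by move=> i j; rewrite /C5_adj orbC. Qed.

Lemma C5_adj_irrefl : irreflexive C5_adj.
Proof. by move=> [[|[|[|[|[|]]]]]]. Qed.

Definition C5 : graph := Graph C5_adj_sym C5_adj_irrefl.

Section Families.
Variable m : nat.

Definition copies_adj (G : graph) : rel (G * 'I_m) :=
  fun u v => (u.2 == v.2) && adj u.1 v.1.

Lemma copies_adj_sym (G : graph) : symmetric (@copies_adj G).
Proof. by move=> u v; rewrite /copies_adj eq_sym adj_sym. Qed.

Lemma copies_adj_irrefl (G : graph) : irreflexive (@copies_adj G).
Proof. by move=> u; rewrite /copies_adj adj_irrefl andbF. Qed.

Definition copies (G : graph) : graph :=
  Graph (@copies_adj_sym G) (@copies_adj_irrefl G).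

Definition cocktail_adj : rel (bool * 'I_m) := fun u v => u.2 != v.2.

Lemma cocktail_adj_sym : symmetric cocktail_adj.
Proof. by move=> u v; rewrite /cocktail_adj eq_sym. Qed.

Lemma cocktail_adj_irrefl : irreflexive cocktail_adj.
Proof. by move=> u; rewrite /cocktail_adj eqxx. Qed.

(** The complete multipartite graph K_{2,...,2} with [m] parts. *)
Definition cocktail : graph := Graph cocktail_adj_sym cocktail_adj_irrefl.

End Families.

Lemma C5_triangle_free (u v w : C5) : adj u v -> adj v w -> ~~ adj u w.
Proof.
by case: u v w => [[|[|[|[|[|u]]]]] Hu] [[|[|[|[|[|v]]]]] Hv] [[|[|[|[|[|w]]]]] Hw].
Qed.

Lemma C5_C4_free (a b c d : C5) :
  adj a b -> adj b c -> adj c d -> adj d a -> a = c \/ b = d.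
Proof.
move=> ab bc cd da; suff: (a == c) || (b == d) by case/orP => /eqP; [left | right].
move: a b c d ab bc cd da.
by move=> [[|[|[|[|[|a]]]]] Ha] [[|[|[|[|[|b]]]]] Hb] // [[|[|[|[|[|c]]]]] Hc] //
  [[|[|[|[|[|d]]]]] Hd].
Qed.

Lemma embeds_copies_minus (K : graph) (m : nat) (S : {set copies m K}) :
  #|S| < m -> embeds K (graph_minus S).
Proof.
rewrite -subn_gt0 => /leq_trans /(_ (card_intact_blocks S)).
case/card_gt0P => j; rewrite inE => /forallP jS.
have jS' (t : K) : ((t, j) : copies m K) \in ~: S by rewrite inE.
exists (fun t => exist _ ((t, j) : copies m K) (jS' t)) => [t u [] //|t u].
by rewrite /= /induced_adj /= /copies_adj /= eqxx.
Qed.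

Lemma embeds_cocktail_minus (m : nat) (S : {set cocktail m}) :
  #|S|.+1 < m -> embeds (cocktail 2) (graph_minus S).
Proof.
rewrite -addn1 -ltn_subRL => /leq_trans /(_ (card_intact_blocks S)).
case/card_gt1P => i [j []]; rewrite !inE => /forallP iS /forallP jS ij.
pose block (k : 'I_2) := if k == ord0 then i else j.
have blockS (u : cocktail 2) : ((u.1, block u.2) : cocktail m) \in ~: S.
  by rewrite inE /block; case: ifP.
have block_inj : injective block.
  move=> [[|[|k]] Hk] [[|[|l]] Hl] //=; rewrite /block /= => E; try exact: val_inj.
    by rewrite E eqxx in ij.
  by rewrite E eqxx in ij.
exists (fun u => exist _ ((u.1, block u.2) : cocktail m) (blockS u)).
  by move=> [a k] [b l] [-> /block_inj ->].
move=> u v.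
by rewrite /= /induced_adj /= /cocktail_adj /= (inj_eq block_inj).
Qed.

Lemma copies_C5_far (R : realType) (m : nat) (S : {set copies m C5}) :
  #|S| < m -> ~ interval_graph R (graph_minus S).
Proof.
move=> /embeds_copies_minus [f finj fadj] /interval_graph_C5 chord.
pose x i (lti : i < 5) := f (Ordinal lti).
have := chord (x 0 isT) (x 1 isT) (x 2 isT) (x 3 isT) (x 4 isT).
by rewrite !fadj !(inj_eq finj) => /(_ isT isT isT isT isT) [].
Qed.

Lemma cocktail_far (R : realType) (m : nat) (S : {set cocktail m}) :
  #|S|.+1 < m -> ~ interval_graph R (graph_minus S).
Proof.
move=> /embeds_cocktail_minus [f finj fadj] /interval_graph_C4 chord.
pose x b (k : 'I_2) := f (b, k).
have := chord (x false ord0) (x false ord_max) (x true ord0) (x true ord_max).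
by rewrite !fadj !(inj_eq finj) => /(_ isT isT isT isT).
Qed.

(** If [x] and [z] are non-adjacent, all other vertices are adjacent to both,
    so two of them would form a 4-cycle with [x] and [z]; hence there is at most
    one, the centre of a P3.  If [H] is complete, then it has no third vertex. *)
Lemma embeds_P3 (H : graph) :
  (forall u v w : H, adj u v -> adj v w -> ~~ adj u w) ->
  (forall a b c d : H, adj a b -> adj b c -> adj c d -> adj d a -> a = c \/ b = d) ->
  (forall u v w : H, u != v -> u != w -> ~~ adj u v -> ~~ adj u w -> v = w) ->
  embeds H P3.
Proof.
move=> triangle_free C4_free nonadj.
have [/existsP[x /existsP[z /andP[xz nxz]]]|/existsPn complete] :=
    boolP [exists x : H, exists z, (x != z) && ~~ adj x z].
  have mid y : y != x -> y != z -> adj x y /\ adj y z.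
    move=> yx yz; split; apply: contraT => nadj.
      by rewrite (nonadj x y z) ?eqxx // 1?eq_sym in yz.
    rewrite adj_sym in nadj.
    by rewrite (nonadj z y x) ?eqxx // 1?eq_sym // adj_sym in yx.
  have uniq_mid y y' : y != x -> y != z -> y' != x -> y' != z -> y = y'.
    move=> yx yz y'x y'z; have [xy yz'] := mid _ yx yz.
    have [xy' yz''] := mid _ y'x y'z.
    have [] // := C4_free x y z y' xy yz'; rewrite 1?adj_sym //.
    by move=> E; rewrite E eqxx in xz.
  pose f u : P3 := if u == x then @Ordinal 3 0 isT
                   else if u == z then @Ordinal 3 2 isT else @Ordinal 3 1 isT.
  have fP u : [\/ u = x /\ f u = @Ordinal 3 0 isT, u = z /\ f u = @Ordinal 3 2 isT
                | [/\ u != x, u != z & f u = @Ordinal 3 1 isT]].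
    rewrite /f; case: eqVneq => [->|ux]; first by constructor 1.
    by case: eqVneq => [->|uz]; [constructor 2 | constructor 3].
  exists f => u v.
    case: (fP u) => [[-> ->]|[-> ->]|[ux uz ->]];
      case: (fP v) => [[-> ->]|[-> ->]|[vx vz ->]] // _.
    exact: uniq_mid.
  case: (fP u) => [[-> ->]|[-> ->]|[ux uz ->]];
    case: (fP v) => [[-> ->]|[-> ->]|[vx vz ->]];
    rewrite ?adj_irrefl ?(negbTE nxz) //.
  - by have [-> _] := mid v vx vz.
  - by rewrite [RHS]adj_sym (negbTE nxz).
  - by have [_ zv] := mid v vx vz; rewrite [RHS]adj_sym zv.
  - by rewrite [RHS]adj_sym; have [-> _] := mid u ux uz.
  - by have [_ ->] := mid u ux uz.
  - by rewrite (uniq_mid u v) // adj_irrefl.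
(* Without non-adjacent pairs, only one vertex can differ from a given [x]. *)
have adjE (u v : H) : adj u v = (u != v).
  have /existsPn/(_ v) := complete u; case: eqVneq => [->|_] /=.
    by rewrite adj_irrefl.
  by move/negbNE.
have [x _|H0] := pickP (mem H); last by exists (fun=> ord0) => u; have := H0 u.
have same u v : u != x -> v != x -> u = v.
  move=> ux vx; apply/eqP/negP => /negP uv.
  by have := triangle_free u v x; rewrite !adjE => /(_ uv vx); rewrite ux.
exists (fun u => if u == x then @Ordinal 3 0 isT else @Ordinal 3 1 isT) => u v /=.
  case: (eqVneq u x) => [->|ux]; case: (eqVneq v x) => [->|vx] // _.
  exact: same.
rewrite adjE; case: (eqVneq u x) => [->|ux]; case: (eqVneq v x) => [vx|vx] //=.
- by rewrite vx ux.
- by rewrite (same u v) ?eqxx.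
Qed.

Theorem theorem7p1 (R : realType) (H : graph) :
  bounded_apex_interval R (H_free H) <-> induced_subgraph_of H P3.
Proof.
split=> [[c far]|/induced_subgraphE HP3]; last first.
  exists 0 => G /H_freeE free; exists finset.set0; first by rewrite cards0.
  apply: P3_free_interval => P3G; apply: free.
  exact: embeds_trans HP3 (embeds_trans P3G (embeds_induced _)).
have embG (G : graph) :
    (forall S : {set G}, #|S| <= c -> ~ interval_graph R (graph_minus S)) ->
    embeds H G.
  move=> Gfar; apply: contrapT => /H_freeE /far [S Sc].
  exact: Gfar.
have [f finj fadj] : embeds H (copies c.+1 C5).
  by apply: embG => S Sc; apply: copies_C5_far; rewrite ltnS.
have [g ginj gadj] : embeds H (cocktail c.+2).
  by apply: embG => S Sc; apply: cocktail_far; rewrite !ltnS.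
apply/induced_subgraphE/embeds_P3.
- move=> u v w; rewrite -!fadj /= /copies_adj => /andP[_ uv] /andP[_ vw].
  by rewrite negb_and (C5_triangle_free uv) ?orbT.
- move=> a b c' d; rewrite -!fadj => /andP[/eqP ab ab'] /andP[/eqP bc bc'].
  move=> /andP[/eqP cd cd'] /andP[_ da'].
  have [ac|bd] := C5_C4_free ab' bc' cd' da'; [left | right]; apply: finj.
    by apply/eqP; rewrite /eq_op /= ac ab bc !eqxx.
  by apply/eqP; rewrite /eq_op /= bd bc cd !eqxx.
(* The part that contains [g u] has just one other vertex. *)
move=> u v w; rewrite -!(inj_eq ginj) -!gadj /= /cocktail_adj !negbK.
move=> uv uw /eqP uv2 /eqP uw2; apply: ginj; move: uv uw uv2 uw2.
case: (g u) (g v) (g w) => [a i] [b j] [d k] /= uv uw ij ik; subst j k.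
by move: a b d uv uw => [] [] []; rewrite ?eqxx.
Qed.
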